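(* Let $n\ge1$ and $r\ge0$ be integers, and let $x=(x_1,\ldots,x_n)$, $u=(u_1,\ldots,u_r)$ and $t$ be indeterminates. Then, as an identity of rational functions, \[ \mathcal{T}\left(\Phi_\pi \, \prod_{k=1}^r \, \prod_{i=1}^n \frac{1-tu_k/x_i}{1-u_k/x_i} \right)= (-t;t)_{n-r} \, \sum_{I \subset \{1,\ldots,r \}} c_I \prod_{i \in I} R(u_i), \] where \[c_I=t^{n(r-|I|)}\prod_{1\le i < j \le r}\frac{1-v_iv_j}{1-tv_iv_j},\] with $v_i=u_i$ if $i\in I$ and $v_i=1/(tu_i)$ if $i\notin I$.
   Context: $\Phi_\pi=\prod_{i=1}^n\frac{1-tx_i^2}{1-x_i^2}\prod_{1\le i<j\le n}\frac{1-tx_ix_j}{1-x_ix_j}$. For $1\le i\le n$, $T_i$ is the operator on rational functions in $x$ substituting $x_i\mapsto 1/x_i$, and $\mathcal{T}=(1+T_1)\cdots(1+T_n)$. $R(u)=\prod_{i=1}^n\frac{1-tux_i}{1-ux_i}\,\frac{1-tu/x_i}{1-u/x_i}$. The symbol $(-t;t)_m$ equals $\prod_{k=1}^{m}(t^k+1)$ if $m\ge0$ and $\prod_{k=0}^{-m-1}(t^{-k}+1)^{-1}$ if $m<0$. *)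

(* Defs.v *)
(* MathComp, with multinomials for polynomials in several indeterminates. *)
From mathcomp Require Import all_boot all_order all_algebra.
From mathcomp Require Import mpoly.

Set Implicit Arguments.
Unset Strict Implicit.
Unset Printing Implicit Defensive.

Import Order.TTheory GRing.Theory Num.Theory.
Local Open Scope ring_scope.

(* The field F(x_1,...,x_n, u_1,...,u_r, t). *)
Notation ratfun F n r := ({fraction {mpoly F[(n + r + 1)%N]}}).

Section RationalFunctions.

Variables (F : fieldType) (n r : nat).
Local Notation K := (ratfun F n r).

(* Positions of x_i, u_k and t in the list (x, u, t) of all indeterminates;
   all indices start at 0. *)
Definition xpos (i : 'I_n) : 'I_(n + r + 1) := lshift 1 (lshift r i).
Definition upos (k : 'I_r) : 'I_(n + r + 1) := lshift 1 (rshift n k).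
Definition tpos : 'I_(n + r + 1) := rshift (n + r) ord0.

Definition indet (j : 'I_(n + r + 1)) : K := FracField.tofrac 'X_j.
Definition x (i : 'I_n) : K := indet (xpos i).
Definition u (k : 'I_r) : K := indet (upos k).
Definition t : K := indet tpos.

Definition subst_poly (s : 'I_(n + r + 1) -> K)
    (p : {mpoly F[(n + r + 1)%N]}) : K :=
  mmap (fun c : F => FracField.tofrac c%:MP) s p.

(* The substitution is made in a chosen numerator and denominator. The result
   depends only on f when no nonzero polynomial is sent to 0, in particular
   for the substitutions used in T. *)
Definition subst (s : 'I_(n + r + 1) -> K) (f : K) : K :=
  subst_poly s \n_(repr f) / subst_poly s \d_(repr f).

Definition T (i : 'I_n) : K -> K :=
  subst (fun j => if j == xpos i then (x i)^-1 else indet j).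

(* (1 + T_1) o ... o (1 + T_n) *)
Definition calT : K -> K :=
  \big[comp/idfun]_(i < n) (fun f => f + T i f).

Definition Phi_pi : K :=
  (\prod_(i < n) ((1 - t * x i ^+ 2) / (1 - x i ^+ 2))) *
  \prod_(i < n) \prod_(j < n | (i < j)%N)
    ((1 - t * x i * x j) / (1 - x i * x j)).

Definition R (w : K) : K :=
  \prod_(i < n) ((1 - t * w * x i) / (1 - w * x i) *
                 ((1 - t * w / x i) / (1 - w / x i))).

(* The symbol (-t;t)_m. *)
Definition qpoch (m : int) : K :=
  match m with
  | Posz p => \prod_(1 <= k < p.+1) (t ^+ k + 1)
  | Negz p => (* m = - (p + 1), hence - m - 1 = p *)
      \prod_(0 <= k < p.+1) (t ^- k + 1)^-1
  end.

Definition v (I : {set 'I_r}) (i : 'I_r) : K :=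
  if i \in I then u i else (t * u i)^-1.

(* The natural-number subtraction is exact since #|I| <= r. *)
Definition c (I : {set 'I_r}) : K :=
  t ^+ (n * (r - #|I|)) *
  \prod_(i < r) \prod_(j < r | (i < j)%N)
    ((1 - v I i * v I j) / (1 - t * v I i * v I j)).

End RationalFunctions.

Arguments x {F n r} i.
Arguments u {F n r} k.
Arguments t {F n r}.
Arguments qpoch {F n r} m.
Arguments Phi_pi {F n r}.

(* Main.v *)
From HB Require Import structures.
Require Import Defs.
From mathcomp Require Import all_boot all_order all_algebra.
From mathcomp Require Import mpoly.
From mathcomp Require Import ring zify.

Set Implicit Arguments.
Unset Strict Implicit.
Unset Printing Implicit Defensive.

Import Order.TTheory GRing.Theory Num.Theory.
Local Open Scope ring_scope.

(* Induction on n. As a function of z = x_1, both sides are rational with poles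
   at most at z = 1, -1, x_j^{+-1}, u_k^{+-1}; after multiplication by the common
   denominator, of degree 2(n + r), their difference is a polynomial that is
   changed to its opposite by z -> 1/z. It vanishes at x_j^{+-1} because the
   residues of the left-hand side cancel in pairs, at 1 and -1 by
   antisymmetry, at u_k^{+-1} by the induction hypothesis for (n - 1, r - 1),
   and at 0 by the induction hypothesis for (n - 1, r): too many roots. The
   case n = 0, the identity
   sum_I prod_(i < j) (1 - v_i v_j) / (1 - t v_i v_j) = prod_(k < r) (1 + t^-k),
   follows in the same way by induction on r. *)

(** The identity is proved for lists of elements of an arbitrary field, subject to finitely many
    inequations, and specialized to indeterminates only at the end. Then z is an ordinary element,
    the induction hypotheses are the same statement for shorter lists in the same field, and
    distinct roots can be counted there. As division by 0 returns 0, a rational function cannot be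
    examined at its poles: everything in z is carried by polynomial numerators, and a residue shows
    up as the value of a numerator at the pole. Both sides are sums of one shape: each variable a
    takes the branch a or q/a, and each pair contributes (1 - al w)/(1 - be w) at the product w of
    its branches, where q be = 1. The left-hand side has (q, al, be) = (1, t, 1); the sum over I has
    (1/t, 1, t), since 1/(tu) is the other branch of u. One cancellation argument thus serves both
    the induction on n and the case n = 0. The count is tight: 3 + 2(n - 1 + r) roots against degree
    2(n + r). *)

Section SignSum.

(** * Sums over sign choices *)

Variable L : comNzRingType.

(** The label [true] will keep a variable and [false] replace it by its other branch. Recursion on
    the list, rather than a sum over sets, splits the sum at its head by computation; this is how
    [z] is singled out. *)
Fixpoint bsum (A : Type) (s : seq A) (g : seq (A * bool) -> L) : L :=
  if s is a :: s' then
    bsum s' (fun l => g ((a, true) :: l)) + bsum s' (fun l => g ((a, false) :: l))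
  else g [::].

Lemma eq_bsum (A : Type) (s : seq A) (g h : seq (A * bool) -> L) :
  (forall l, map fst l = s -> g l = h l) -> bsum s g = bsum s h.
Proof.
elim: s g h => [|a s IHs] g h gh /=; first exact: gh.
by congr (_ + _); apply: IHs => l ls; apply: gh; rewrite /= ls.
Qed.

Lemma bsumD (A : Type) (s : seq A) (g h : seq (A * bool) -> L) :
  bsum s (fun l => g l + h l) = bsum s g + bsum s h.
Proof. by elim: s g h => //= a s IHs g h; rewrite !IHs addrACA. Qed.

Lemma mulr_bsumr (A : Type) (s : seq A) c (g : seq (A * bool) -> L) :
  c * bsum s g = bsum s (fun l => c * g l).
Proof. by elim: s g => //= a s IHs g; rewrite mulrDr !IHs. Qed.

Lemma bsum_cat (A : Type) (s1 s2 : seq A) (g : seq (A * bool) -> L) :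
  bsum (s1 ++ s2) g = bsum s1 (fun l1 => bsum s2 (fun l2 => g (l1 ++ l2))).
Proof. by elim: s1 g => //= a s IHs g; rewrite !IHs. Qed.

Lemma exchange_bsum (A B : Type) (s1 : seq A) (s2 : seq B)
    (g : seq (A * bool) -> seq (B * bool) -> L) :
  bsum s1 (fun l1 => bsum s2 (g l1)) = bsum s2 (fun l2 => bsum s1 (g^~ l2)).
Proof.
elim: s1 g => //= a s IHs g.
by rewrite (IHs (fun l => g ((a, true) :: l))) (IHs (fun l => g ((a, false) :: l))) -bsumD.
Qed.

(** Exchanges of two leading blocks generate all permutations, and for those the nested sums
    commute. *)
Lemma perm_bsum (A : eqType) (s1 s2 : seq A) (g : seq (A * bool) -> L) :
    (forall l1 l2, perm_eq l1 l2 -> g l1 = g l2) ->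
  perm_eq s1 s2 -> bsum s1 g = bsum s2 g.
Proof.
move=> gP; apply: (catCA_perm_subst (F := fun s => bsum s g)) => {}s1 {}s2 s3.
rewrite !bsum_cat; under eq_bsum do rewrite bsum_cat.
rewrite exchange_bsum; apply: eq_bsum => l2 _; rewrite bsum_cat.
apply: eq_bsum => l1 _; apply: eq_bsum => l3 _; apply: gP.
by rewrite perm_catCA.
Qed.

(** A factor blind to the labels is the same in every term; this clears denominators in all terms at
    once. *)
Lemma bsum_prodM (A : Type) (s : seq A) (c : A -> L) (g : seq (A * bool) -> L) :
  bsum s (fun l => (\prod_(p <- l) c p.1) * g l) = (\prod_(a <- s) c a) * bsum s g.
Proof.
rewrite mulr_bsumr; apply: eq_bsum => l <-.
by rewrite big_map.
Qed.

Lemma bsum_map (A B : Type) (f : A -> B) (s : seq A) (g : seq (B * bool) -> L) :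
  bsum (map f s) g = bsum s (fun l => g [seq (f p.1, p.2) | p <- l]).
Proof. by elim: s g => //= a s IHs g; rewrite !IHs. Qed.

(** A labelling of distinct entries amounts to the set of those labelled [true]. The sets with and
    without the head match the two halves of the recursion. *)
Lemma bsum_set (A : finType) (s : seq A) (g : seq (A * bool) -> L) : uniq s ->
  bsum s g = \sum_(I : {set A} | I \subset s) g [seq (i, i \in I) | i <- s].
Proof.
elim: s g => [|a s IHs] g /=.
  move=> _; rewrite (big_pred1 set0) // => I.
  apply/subsetP/eqP => [sI|-> i]; last by rewrite inE.
  by apply/setP=> i; rewrite inE; apply/negbTE/negP => /sI.
move=> /andP[aNs us]; rewrite !IHs // [RHS](bigID (fun I : {set A} => a \in I)) /=.
have aI (I : {set A}) : I \subset s -> a \notin I.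
  by move=> /subsetP sI; apply: contra aNs => /sI.
congr (_ + _).
  rewrite [RHS](reindex_onto (fun I => a |: I) (fun I => I :\ a)) /=; last first.
    by move=> I /andP[_ ?]; rewrite setD1K.
  apply: eq_big => [I|I sI].
    rewrite setU11 andbT; apply/idP/andP => [sI|[sI /eqP eI]].
      rewrite setU1K ?aI //; split => //.
      apply/subsetP => i; rewrite !inE => /orP[->//|iI].
      by rewrite (subsetP sI) ?orbT.
    apply/subsetP => i iI; have: i \in (a |: I) :\ a by rewrite eI.
    rewrite 2!inE => /andP[ia /(subsetP sI)].
    by rewrite inE (negPf ia).
  rewrite setU11; congr (g (_ :: _)); apply/eq_in_map => i si.
  by rewrite !inE; case: eqP => // ia; rewrite ia (negPf aNs) in si.
apply: eq_big => [I|I sI].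
  apply/idP/andP => [sI|[/subsetP sI aNI]].
    split; last exact: aI.
    by apply/subsetP => i /(subsetP sI); rewrite inE => ->; rewrite orbT.
  apply/subsetP => i iI; have := sI i iI; rewrite inE => /orP[/eqP ia|//].
  by rewrite ia (negPf aNI) in iI.
by rewrite (negPf (aI I sI)).
Qed.

End SignSum.

(** * Products over pairs *)

Section PairProduct.
Variables (L : comNzRingType) (A : Type) (k : A -> A -> L).

Fixpoint pprod (l : seq A) : L :=
  if l is a :: l' then (\prod_(b <- l') k a b) * pprod l' else 1.

Lemma pprod_cat l1 l2 : pprod (l1 ++ l2) =
  pprod l1 * pprod l2 * \prod_(a <- l1) \prod_(b <- l2) k a b.
Proof.
elim: l1 => [|a l1 IHl] /=; first by rewrite big_nil mul1r mulr1.
by rewrite big_cons big_cat IHl /=; ring.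
Qed.

End PairProduct.

Lemma pprod_map (L : comNzRingType) (A B : Type) (f : A -> B) (k : B -> B -> L) l :
  pprod k (map f l) = pprod (fun a b => k (f a) (f b)) l.
Proof. by elim: l => //= a l ->; rewrite big_map. Qed.

(** In a list sorted by a strict order, the entries after [i] are exactly the [j] with [r i j]. *)
Lemma pprod_sorted (L : comNzRingType) (A : eqType) (k : A -> A -> L) (r : rel A) l :
    irreflexive r -> transitive r -> sorted r l ->
  \prod_(i <- l) \prod_(j <- l | r i j) k i j = pprod k l.
Proof.
move=> rI rT; elim: l => [|a l IHl] /=; first by rewrite big_nil.
move=> al; have /andP[/allP al1 ls]: all (r a) l && sorted r l.
  by rewrite (order_path_min rT al) (path_sorted al).
rewrite big_cons big_cons rI; congr (_ * _).
  by rewrite big_seq_cond [RHS]big_seq_cond; apply: eq_bigl => j;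
     case: (boolP (j \in l)) => // /al1 ->.
rewrite -IHl //; apply: eq_big_seq => i il; rewrite big_cons.
case: ifP => // ria; have := rT _ _ _ (al1 i il) ria.
by rewrite rI.
Qed.

Lemma perm_pprod (L : comNzRingType) (A : eqType) (k : A -> A -> L) l1 l2 :
    (forall a b, k a b = k b a) -> perm_eq l1 l2 ->
  pprod k l1 = pprod k l2.
Proof.
move=> kC; apply: catCA_perm_subst => {}l1 {}l2 l3; rewrite !pprod_cat.
have -> : \prod_(a <- l1) \prod_(b <- l2 ++ l3) k a b =
  (\prod_(a <- l1) \prod_(b <- l2) k a b) * \prod_(a <- l1) \prod_(b <- l3) k a b.
  by rewrite -big_split; apply: eq_bigr => a _; rewrite big_cat.
have -> : \prod_(a <- l2) \prod_(b <- l1 ++ l3) k a b =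
  (\prod_(a <- l1) \prod_(b <- l2) k a b) * \prod_(a <- l2) \prod_(b <- l3) k a b.
  rewrite [in RHS]exchange_big -big_split; apply: eq_bigr => a _; rewrite big_cat /=.
  by congr (_ * _); apply: eq_bigr => b _; rewrite kC.
by ring.
Qed.

(** * Polynomial functions of bounded degree and their roots *)

Section PolyFun.
Variable L : fieldType.

(** A predicate on functions lets numerators be written and evaluated as plain field expressions,
    while the bound needed to count roots is kept. *)
Definition polyfun (d : nat) (g : L -> L) :=
  exists2 P : {poly L}, (size P <= d.+1)%N & forall z, g z = P.[z].

Lemma polyfun_leq d d' g : (d <= d')%N -> polyfun d g -> polyfun d' g.
Proof. by move=> dd' [P sP gP]; exists P => //; apply: leq_trans sP _. Qed.

Lemma eq_polyfun d g h : g =1 h -> polyfun d g -> polyfun d h.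
Proof. by move=> gh [P sP gP]; exists P => // z; rewrite -gh. Qed.

Lemma polyfunC d c : polyfun d (fun=> c).
Proof.
exists c%:P; last by move=> z; rewrite hornerC.
by apply: leq_trans (size_polyC_leq1 _) _.
Qed.

Lemma polyfun_id : polyfun 1 id.
Proof. by exists 'X; [rewrite size_polyX | move=> z; rewrite hornerX]. Qed.

Lemma polyfunD d g h : polyfun d g -> polyfun d h -> polyfun d (fun z => g z + h z).
Proof.
move=> [P sP gP] [Q sQ hQ]; exists (P + Q); last by move=> z; rewrite hornerD gP hQ.
by apply: leq_trans (size_polyD _ _) _; rewrite geq_max sP.
Qed.

Lemma polyfunM d e g h :
  polyfun d g -> polyfun e h -> polyfun (d + e) (fun z => g z * h z).
Proof.
move=> [P sP gP] [Q sQ hQ]; exists (P * Q); last by move=> z; rewrite hornerM gP hQ.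
apply: leq_trans (size_polyMleq _ _) _.
by move: (leq_add sP sQ); rewrite addnS addSn; case: (_ + _)%N.
Qed.

Lemma polyfunN d g : polyfun d g -> polyfun d (fun z => - g z).
Proof. by move=> [P sP gP]; exists (- P); [rewrite size_polyN | move=> z; rewrite hornerN gP]. Qed.

Lemma polyfunB d g h : polyfun d g -> polyfun d h -> polyfun d (fun z => g z - h z).
Proof. by move=> pg ph; apply: polyfunD => //; apply: polyfunN. Qed.

Lemma polyfunMl d c g : polyfun d g -> polyfun d (fun z => c * g z).
Proof. exact: (polyfunM (polyfunC 0 c)). Qed.

Lemma polyfun_affine a b : polyfun 1 (fun z => a + b * z).
Proof. by apply: polyfunD (polyfunC _ _) _; apply: polyfunMl polyfun_id. Qed.

Lemma polyfun_prod (A : Type) d (s : seq A) (g : A -> L -> L) :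
    (forall a, polyfun d (g a)) ->
  polyfun (d * size s) (fun z => \prod_(a <- s) g a z).
Proof.
move=> pg; elim: s => [|a s IHs] /=.
  by apply: eq_polyfun (polyfunC _ 1) => z; rewrite big_nil.
rewrite mulnS; apply: eq_polyfun (polyfunM (pg a) IHs) => z.
by rewrite big_cons.
Qed.

Lemma polyfun_bsum (A : Type) d (s : seq A) (g : L -> seq (A * bool) -> L) :
    (forall l, map fst l = s -> polyfun d (g^~ l)) ->
  polyfun d (fun z => bsum s (g z)).
Proof.
elim: s g => /= [|a s IHs] g pg; first exact: (pg [::]).
by apply: polyfunD; apply: IHs => l ls; apply: pg; rewrite /= ls.
Qed.

Lemma polyfun_eq0 d g (rs : seq L) : polyfun d g -> uniq rs -> (d < size rs)%N ->
  {in rs, forall z, g z = 0} -> forall z, g z = 0.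
Proof.
move=> [P sP gP] urs srs g0 z; rewrite gP.
have [->|P0] := eqVneq P 0; first by rewrite horner0.
have rP : all (root P) rs by apply/allP => a /g0; rewrite gP => /rootP.
by have := max_poly_roots P0 rP urs; rewrite ltnNge (leq_trans sP).
Qed.

End PolyFun.

Lemma prod_const_seq (R : comNzRingType) (A : Type) (s : seq A) (c : R) :
  \prod_(a <- s) c = c ^+ size s.
Proof. by rewrite big_const_seq count_predT -Monoid.iteropE. Qed.

Lemma prodM_exp (R : comNzRingType) (A : Type) (s : seq A) (f : A -> R) c :
  (\prod_(a <- s) f a) * c ^+ size s = \prod_(a <- s) (f a * c).
Proof. by rewrite big_split prod_const_seq. Qed.

(** * Sums over branches as rational functions of one variable *)

Section Kernel.
Variables (L : fieldType) (q al be : L).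
Hypothesis qbe : q * be = 1.

Definition branch (p : L * bool) : L := if p.2 then p.1 else q / p.1.

(** As [q * be = 1], the pole is at [w = q], the product of the two branches of a variable:
    [kernel (z * y)] has its pole where [z] meets the other branch of [y]. *)
Definition kernel (w : L) : L := (1 - al * w) / (1 - be * w).

Definition weight (phi : L * bool -> L) (l : seq (L * bool)) : L :=
  (\prod_(p <- l) phi p) * pprod (fun p p' => kernel (branch p * branch p')) l.

Lemma weight_cons phi p l : weight phi (p :: l) =
  phi p * (\prod_(p' <- l) kernel (branch p * branch p')) * weight phi l.
Proof. by rewrite /weight big_cons /=; ring. Qed.

Lemma weightM phi psi l : weight (fun p => psi p * phi p) l =
  (\prod_(p <- l) psi p) * weight phi l.
Proof. by rewrite /weight big_split mulrA. Qed.

Lemma eq_in_weight phi psi l : {in l, phi =1 psi} -> weight phi l = weight psi l.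
Proof. by move=> e; rewrite /weight; congr (_ * _); apply: eq_big_seq. Qed.

Lemma perm_weight phi l1 l2 : perm_eq l1 l2 -> weight phi l1 = weight phi l2.
Proof.
move=> e; rewrite /weight (perm_big _ e); congr (_ * _).
by apply: perm_pprod e => a b; rewrite mulrC.
Qed.

Lemma q_neq0 : q != 0.
Proof. by apply/eqP => q0; have := oner_neq0 L; rewrite -qbe q0 mul0r eqxx. Qed.

Lemma be_def : be = q^-1.
Proof. by apply: (mulfI q_neq0); rewrite qbe divff // q_neq0. Qed.

Lemma branch_neq0 p : p.1 != 0 -> branch p != 0.
Proof. by case: p => a [] //= a0; rewrite mulf_neq0 ?invr_eq0 ?q_neq0. Qed.

(* Up to a constant, [polepart z x] is [(z - x) (z - q / x)]: the common
   denominator of [kernel (z * y)] and [kernel (q / z * y)] for [y] any of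
   the two branches [x], [q / x], on which it does not depend. *)
Definition polepart (z x : L) : L := (x^-1 - be * z) * (z - x).
Definition num0 (z y : L) : L := (1 - al * z * y) * (z - y) / y.
Definition num1 (z y : L) : L := (z - al * q * y) * (y^-1 - be * z).

Lemma polepart_branch z p : p.1 != 0 -> polepart z (branch p) = polepart z p.1.
Proof.
case: p => a [] //= a0; rewrite /polepart /branch /= be_def.
by field; rewrite a0 q_neq0.
Qed.

Lemma polepart_neq0 z x : x != 0 -> z != x -> z * x != q -> polepart z x != 0.
Proof.
move=> x0 zx zxq; rewrite mulf_neq0 ?subr_eq0 //.
apply: contra zxq => /eqP e; apply/eqP.
have -> : z * x = q * (be * z) * x by rewrite mulrA qbe mul1r.
by rewrite -e mulfVK.
Qed.

Lemma polepart_factors z x : x != 0 -> polepart z x != 0 ->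
  (1 - be * (z * x) != 0) /\ (z - x != 0).
Proof.
move=> x0; rewrite mulf_eq0 negb_or => /andP[h1 ->]; split => //.
apply: contra h1 => /eqP h.
have -> : x^-1 - be * z = (1 - be * (z * x)) / x by field.
by rewrite h mul0r.
Qed.

Lemma kernel_num0 z y : y != 0 -> polepart z y != 0 ->
  kernel (z * y) * polepart z y = num0 z y.
Proof.
move=> y0 /(polepart_factors y0)[h1 h2].
by rewrite /kernel /polepart /num0; field; rewrite y0 h1.
Qed.

Lemma kernel_num1 z y : y != 0 -> z != 0 -> polepart z y != 0 ->
  kernel (q / z * y) * polepart z y = num1 z y.
Proof.
move=> y0 z0 /(polepart_factors y0)[h1 h2].
rewrite /kernel /polepart /num1.
have -> : be * (q / z * y) = y / z by rewrite !mulrA (mulrC be) qbe mul1r mulrC.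
by field; rewrite y0 z0 h2.
Qed.

(* The numerator of the branching sum over [z :: xs] as a polynomial in [z],
   when [phi z = e0 z / E z] and [phi (q / z) = e1 z / E z]. *)
Definition numsum (phi : L * bool -> L) (e0 e1 : L -> L) (xs : seq L) (z : L) : L :=
  bsum xs (fun l => weight phi l *
    (e0 z * (\prod_(p <- l) num0 z (branch p)) +
     e1 z * \prod_(p <- l) num1 z (branch p))).

(** [polepart z x] is the same for both branches of [x], so one product clears the denominators of
    every labelling and comes out of the sum. *)
Lemma bsum_numsum phi e0 e1 E xs z :
    z != 0 -> {in xs, forall x, x != 0} ->
    {in xs, forall x, polepart z x != 0} ->
    phi (z, true) * E = e0 z -> phi (z, false) * E = e1 z ->
  bsum (z :: xs) (weight phi) * (E * \prod_(x <- xs) polepart z x) =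
  numsum phi e0 e1 xs z.
Proof.
move=> z0 xs0 mz h0 h1 /=; rewrite -bsumD mulrC mulr_bsumr.
apply: eq_bsum => l lxs.
have lP p : p \in l -> p.1 != 0 /\ polepart z p.1 != 0.
  move=> pl; have px : p.1 \in xs by rewrite -lxs map_f.
  by rewrite xs0 ?mz.
rewrite !weight_cons -lxs big_map -h0 -h1.
have -> : \prod_(p <- l) num0 z (branch p) =
   (\prod_(p <- l) kernel (z * branch p)) * \prod_(p <- l) polepart z p.1.
  rewrite -big_split; apply: eq_big_seq => p /lP[p0 mp].
  by rewrite -(kernel_num0 (branch_neq0 p0)) polepart_branch.
have -> : \prod_(p <- l) num1 z (branch p) =
   (\prod_(p <- l) kernel (q / z * branch p)) * \prod_(p <- l) polepart z p.1.
  rewrite -big_split; apply: eq_big_seq => p /lP[p0 mp].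
  by rewrite -(kernel_num1 (branch_neq0 p0)) ?polepart_branch.
by rewrite /branch /=; ring.
Qed.

Lemma perm_numsum phi e0 e1 xs ys z : perm_eq xs ys ->
  numsum phi e0 e1 xs z = numsum phi e0 e1 ys z.
Proof.
apply: perm_bsum => l1 l2 e.
by rewrite (perm_weight _ e) !(perm_big _ e).
Qed.

(** Passing from [x] to [q / x] only exchanges the two labels of the head, if [phi] sees nothing but
    the branch. A root at [x] thereby carries over to [q / x]. *)
Lemma numsum_flip phi e0 e1 x xs z :
    x != 0 -> (forall p p', branch p = branch p' -> phi p = phi p') ->
  numsum phi e0 e1 (q / x :: xs) z = numsum phi e0 e1 (x :: xs) z.
Proof.
move=> x0 phiP; rewrite /numsum /= addrC; congr (_ + _).
  apply: eq_bsum => l _; have e : branch (q / x, false) = branch (x, true).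
    by rewrite /branch /= invf_div mulrC mulfVK ?q_neq0.
  by rewrite !big_cons !weight_cons e (phiP _ _ e).
apply: eq_bsum => l _; have e : branch (q / x, true) = branch (x, false) by [].
by rewrite !big_cons !weight_cons e (phiP _ _ e).
Qed.

(* The branches [(z, q / x)] and [(q / z, x)] of the first two variables have
   opposite residues at [z = x]. *)
Lemma numsum_root_head phi e0 e1 x xs :
    x != 0 -> {in xs, forall w, w != 0} ->
    {in xs, forall w, polepart x w != 0} ->
    phi (x, true) * e1 x = phi (x, false) * e0 x ->
  numsum phi e0 e1 (x :: xs) x = 0.
Proof.
move=> x0 xs0 mx h; rewrite /numsum /= -bsumD.
rewrite -[RHS](mul0r (bsum xs (fun=> 0))) mulr_bsumr; apply: eq_bsum => l lxs.
have lP p : p \in l -> p.1 != 0 /\ polepart x p.1 != 0.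
  move=> pl; have px : p.1 \in xs by rewrite -lxs map_f.
  by rewrite xs0 ?mx.
rewrite !weight_cons !big_cons mul0r.
(* Of the four terms given by the branches of [z] and of the head, the two with equal branches
   vanish at [z = x]. *)
have -> : num0 x (branch (x, true)) = 0 by rewrite /num0 subrr mulr0 mul0r.
have -> : num1 x (branch (x, false)) = 0.
  by rewrite /num1 /branch /= invf_div be_def [_ * x]mulrC subrr mulr0.
(* In both surviving terms the other variables meet the same pair [x], [q / x]; only the roles of
   [z] and of the head are exchanged. *)
have cross : (\prod_(p <- l) kernel (branch (x, true) * branch p)) *
     (\prod_(p <- l) num1 x (branch p)) =
   (\prod_(p <- l) kernel (branch (x, false) * branch p)) *
     (\prod_(p <- l) num0 x (branch p)).
  rewrite -!big_split; apply: eq_big_seq => p /lP[p0 mp] /=.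
  rewrite -kernel_num0 -?kernel_num1 ?branch_neq0 ?polepart_branch //.
  by rewrite /branch /=; ring.
have e : num1 x (branch (x, true)) = - num0 x (branch (x, false)).
  by rewrite /num1 /num0 /branch /= be_def; field; rewrite x0 q_neq0.
rewrite e.
have := congr2 ( *%R) h cross; set X := \prod_(p <- l) _.
set Y := \prod_(p <- l) num1 _ _; set Z := \prod_(p <- l) kernel _.
set W := \prod_(p <- l) num0 _ _; set N := num0 _ _; set G := weight _ _.
move=> H.
have -> : phi (x, true) * X * G * (e0 x * (0 * W) + e1 x * (- N * Y)) +
   phi (x, false) * Z * G * (e0 x * (N * W) + e1 x * (0 * Y)) =
  G * N * (phi (x, false) * e0 x * (Z * W) - phi (x, true) * e1 x * (X * Y)) by ring.
by rewrite H subrr mulr0.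
Qed.

Lemma numsum_root phi e0 e1 xs x : x \in xs -> uniq xs ->
    {in xs, forall a, a != 0} -> {in xs &, forall a b, a * b != q} ->
    phi (x, true) * e1 x = phi (x, false) * e0 x ->
  numsum phi e0 e1 xs x = 0.
Proof.
move=> xxs uxs xs0 xsq h; rewrite (perm_numsum _ _ _ _ (perm_to_rem xxs)).
have rP w : w \in rem x xs -> w \in xs /\ x != w.
  by rewrite mem_rem_uniq // inE => /andP[wx ->]; rewrite eq_sym.
apply: numsum_root_head => // [|w /rP[wxs _]|w /rP[wxs xw]]; try exact: xs0.
by apply: polepart_neq0; rewrite ?xs0 ?xsq.
Qed.

Lemma numsum_root_flip phi e0 e1 xs x : x \in xs -> uniq xs ->
    {in xs, forall a, a != 0} -> {in xs &, forall a b, a * b != q} ->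
    (forall p p', branch p = branch p' -> phi p = phi p') ->
    phi (q / x, true) * e1 (q / x) = phi (q / x, false) * e0 (q / x) ->
  numsum phi e0 e1 xs (q / x) = 0.
Proof.
move=> xxs uxs xs0 xsq phiP h.
have x0 := xs0 x xxs.
rewrite (perm_numsum _ _ _ _ (perm_to_rem xxs)) -numsum_flip //.
have rP w : w \in rem x xs -> w \in xs /\ x != w.
  by rewrite mem_rem_uniq // inE => /andP[wx ->]; rewrite eq_sym.
apply: numsum_root_head => // [|w /rP[wxs _]|w /rP[wxs xw]].
- by rewrite mulf_neq0 ?invr_eq0 ?q_neq0.
- exact: xs0.
apply: polepart_neq0; first exact: xs0.
  by apply: contra (xsq x w xxs wxs) => /eqP <-; rewrite mulrC mulfVK.
apply: contra xw => /eqP e; rewrite eq_sym -subr_eq0.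
have /eqP : q * (w - x) = 0.
  by rewrite mulrBr -{2}e; field.
by rewrite mulf_eq0 (negPf q_neq0).
Qed.

Lemma polyfun_polepart xs : polyfun (2 * size xs) (fun z => \prod_(x <- xs) polepart z x).
Proof.
apply: polyfun_prod => x; apply: (@polyfunM _ 1 1).
  by apply: eq_polyfun (polyfun_affine x^-1 (- be)) => z; ring.
by apply: eq_polyfun (polyfun_affine (- x) 1) => z; ring.
Qed.

Lemma polyfun_numsum phi e0 e1 xs d : polyfun d e0 -> polyfun d e1 ->
  polyfun (d + 2 * size xs) (numsum phi e0 e1 xs).
Proof.
move=> pe0 pe1; apply: polyfun_bsum => l lxs; apply: polyfunMl.
rewrite -lxs size_map; apply: polyfunD; apply: polyfunM => //;
  apply: polyfun_prod => p.
  (* [branch p / branch p] is not simplified to 1, so that the equality also holds when the branch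
     is 0. *)
  apply: (@eq_polyfun _ _ (fun z =>
    (1 + (- (al * branch p)) * z) * (- (branch p / branch p) + (branch p)^-1 * z))).
    by move=> z; rewrite /num0; ring.
  exact: (@polyfunM _ 1 1 _ _ (polyfun_affine _ _) (polyfun_affine _ _)).
apply: (@eq_polyfun _ _ (fun z =>
    (- (al * q * branch p) + 1 * z) * ((branch p)^-1 + (- be) * z))).
  by move=> z; rewrite /num1; ring.
exact: (@polyfunM _ 1 1 _ _ (polyfun_affine _ _) (polyfun_affine _ _)).
Qed.

End Kernel.

Lemma uniq_flip (L : fieldType) (q : L) (s : seq L) : q != 0 -> uniq s ->
    {in s, forall a, a != 0} -> {in s &, forall a b, a * b != q} ->
  uniq (s ++ [seq q / a | a <- s]).
Proof.
move=> q0 us s0 sq; rewrite cat_uniq us map_inj_in_uniq.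
  rewrite us andbT; apply/hasPn => _ /mapP[a sa ->]; apply/negP => sqa.
  by have := sq _ _ sqa sa; rewrite mulfVK ?eqxx ?s0.
by move=> a b sa sb /(mulfI q0)/invr_inj.
Qed.

(** * The case n = 0 *)

Section BaseCase.
Variables (L : fieldType) (t : L).
Hypothesis t0 : t != 0.

Definition qpochV (r : nat) : L := \prod_(0 <= k < r) (t ^- k + 1).

(** Writing [v = w / sqrt t] gives the sum over sign changes of [w] for the root system of type D,
    with parameter 1/t. Without one-variable factors the numerator has degree at most [2 * size us],
    and 0 together with both branches of the remaining variables is one root more. *)
Lemma bsum_kernel_typeD (us : seq L) : uniq us ->
    {in us, forall a, a != 0} -> {in us &, forall a b, t * a * b != 1} ->
  bsum us (weight t^-1 1 t (fun=> 1)) = qpochV (size us).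
Proof.
have qb : t^-1 * t = 1 by rewrite mulVf.
elim: us => [|z0 us IHs] /=.
  by rewrite /qpochV /weight !big_nil /= mulr1.
move=> /andP[z0us uus] h0 ht.
have us0 : {in us, forall a, a != 0} by move=> a sa; rewrite h0 // inE sa orbT.
have ust : {in us &, forall a b, a * b != t^-1}.
  move=> a b sa sb; apply: contra (ht a b _ _); rewrite ?inE ?sa ?sb ?orbT //.
  by rewrite -mulrA => /eqP ->; rewrite divff.
have z00 : z0 != 0 by rewrite h0 ?inE ?eqxx.
have mz : {in us, forall a, polepart t z0 a != 0}.
  move=> a sa; apply: (polepart_neq0 qb); rewrite ?us0 //.
    by apply: contra z0us => /eqP ->.
  apply: contra (ht z0 a _ _); rewrite ?inE ?eqxx ?sa ?orbT //.
  by rewrite -mulrA => /eqP ->; rewrite divff.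
pose N z := numsum t^-1 1 t (fun=> 1) (fun=> 1) (fun=> 1) us z -
  qpochV (size us).+1 * \prod_(u <- us) polepart t z u.
suff N0 : N z0 = 0.
  have := bsum_numsum 1 (phi := fun=> 1) (E := 1) (e0 := fun=> 1) (e1 := fun=> 1)
    qb z00 us0 mz (mulr1 _) (mulr1 _).
  rewrite (subr0_eq N0) mul1r => /mulIf; apply.
  rewrite prodf_seq_neq0; apply/allP => a sa; exact: mz.
apply: (@polyfun_eq0 _ (2 * size us) N (0 :: us ++ [seq t^-1 / a | a <- us])).
- apply: polyfunB; last exact/polyfunMl/polyfun_polepart.
  apply: (polyfun_leq (d := 0 + 2 * size us)) => //.
  by apply: polyfun_numsum; apply: polyfunC.
- rewrite /= uniq_flip ?invr_eq0 // andbT mem_cat negb_or; apply/andP; split.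
    by apply/negP => /us0; rewrite eqxx.
  apply/negP => /mapP[a sa /esym/eqP].
  by rewrite mulf_eq0 !invr_eq0 (negPf t0) (negPf (us0 a sa)).
- by rewrite /= size_cat size_map addnn mul2n.
move=> z; rewrite inE mem_cat => /or3P[/eqP ->|sz|/mapP[a sa ->]]; rewrite /N.
(* At 0 each [num0] and [polepart] is -1 and each [num1] is -1/t, whatever the branch. With m =
   [size us] the sum becomes (-1)^m (1 + t^-m) times the smaller one, and 1 + t^-m is the last
   factor of [qpochV m.+1]. *)
- have -> : \prod_(u <- us) polepart t 0 u = \prod_(u <- us) -1.
    by apply: eq_big_seq => u su; rewrite /polepart; field; exact: us0.
  rewrite [X in X - _](_ : _ = (\prod_(u <- us) -1 + \prod_(u <- us) - t^-1) * qpochV (size us)).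
    rewrite !prod_const_seq /qpochV big_nat_recr //=.
    by rewrite (exprNn t^-1) exprVn; ring.
  rewrite -IHs // ?mulr_bsumr; last by move=> a b sa sb; apply: ht; rewrite inE ?sa ?sb orbT.
  apply: eq_bsum => l lus; rewrite mulrC -lus !big_map !mul1r; congr ((_ + _) * _);
    apply: eq_big_seq => p pl;
    (have p0 : branch t^-1 p != 0 by apply: (branch_neq0 qb); rewrite us0 // -lus map_f).
    by rewrite /num0; field.
  by rewrite /num1; field; rewrite p0 t0.
- rewrite (numsum_root _ qb) // sub0r (big_rem z) //= /polepart subrr mulr0.
  by rewrite mul0r mulr0 oppr0.
- rewrite (numsum_root_flip _ qb) // sub0r (big_rem a) //= /polepart.
  by rewrite [t * _]mulrA divff // mul1r subrr !mul0r mulr0 oppr0.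
Qed.

End BaseCase.

(** * The identity for generic elements of a field *)

Section GenericIdentity.
Variables (L : fieldType) (t : L).
Hypothesis t0 : t != 0.
Hypothesis tX1 : forall k, t ^+ k + 1 != 0.

(** The symbol (-t;t)_m again, with [t] now an element of any field. *)
Definition qpoch_at (m : int) : L :=
  match m with
  | Posz p => \prod_(1 <= k < p.+1) (t ^+ k + 1)
  | Negz p => \prod_(0 <= k < p.+1) (t ^- k + 1)^-1
  end.

Lemma tVX1 k : t ^- k + 1 != 0.
Proof.
have -> : t ^- k + 1 = (t ^+ k + 1) / t ^+ k.
  by rewrite mulrDl divff ?expf_neq0 // mul1r addrC.
by rewrite mulf_neq0 ?invr_eq0 ?expf_neq0.
Qed.

(** For n = 0 the left-hand side is 1, so the symbol has to invert the sum found in the base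
    case. *)
Lemma qpoch_at0 (r : nat) : qpoch_at (0%:Z - r%:Z) * qpochV t r = 1.
Proof.
case: r => [|r]; first by rewrite subr0 /qpoch_at /qpochV !big_nat !big1 ?mulr1 // => i; case: i.
rewrite sub0r -NegzE /= /qpochV -big_split big1_seq //= => k _.
by rewrite mulVf ?tVX1.
Qed.

(** This is (-t;t)_{m+1} = (1 + t^(m+1)) (-t;t)_m for m = n - r, times t^r to keep exponents
    natural. The two powers of t are those left by the two branches of z at z = 0. *)
Lemma qpoch_atS (n r : nat) :
  (t ^+ r + t ^+ n.+1) * qpoch_at (n%:Z - r%:Z) = t ^+ r * qpoch_at (n.+1%:Z - r%:Z).
Proof.
have [rn|] := leqP r n.
  rewrite !subzn ?(leqW rn) // subSn //=.
  rewrite [in RHS]big_nat_recr //= [_ * (_ + 1)]mulrC mulrA; congr (_ * _).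
  by rewrite mulrDr mulr1 -exprD -subSn // subnKC ?(leqW rn) // addrC.
(* Here n - r = -(p + 1). If p = 0 the next index is 0, which is a [Posz]; hence the case split on p
   below. *)
move=> /subnKC <-; set p := (r - n.+1)%N.
have -> : n%:Z - (n.+1 + p)%N%:Z = Negz p by rewrite NegzE addSnnS PoszD; ring.
have -> : n.+1%:Z - (n.+1 + p)%N%:Z = - p%:Z by rewrite PoszD; ring.
have e : t ^+ (n.+1 + p) + t ^+ n.+1 = t ^+ (n.+1 + p) * (t ^- p + 1).
  by rewrite mulrDr mulr1 exprD mulfK ?expf_neq0 // addrC.
rewrite e -mulrA; congr (_ * _); case: p {e} => [|p].
  by rewrite oppr0 /= big_nat1 big_nil mulfV // tVX1.
rewrite -NegzE /=.
by rewrite big_nat_recr //= [_ * (_ + 1)^-1]mulrC mulVKf ?tVX1.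
Qed.

Definition phi (us : seq L) (z : L) : L :=
  (1 - t * z ^+ 2) / (1 - z ^+ 2) * \prod_(u <- us) ((1 - t * u / z) / (1 - u / z)).

Definition lsum (us xs : seq L) : L :=
  bsum xs (weight 1 t 1 (fun p => phi us (branch 1 p))).

Definition Rprod (xs : seq L) (w : L) : L :=
  \prod_(x <- xs) ((1 - t * w * x) / (1 - w * x) * ((1 - t * w / x) / (1 - w / x))).

(** The power t^(n(r - |I|)) is shared out as t^n for each index outside I. *)
Definition rweight (xs : seq L) (p : L * bool) : L :=
  if p.2 then Rprod xs p.1 else t ^+ size xs.

Definition rsum (us xs : seq L) : L := bsum us (weight t^-1 1 t (rweight xs)).

(** Stands in for algebraic independence: denominators are nonzero and interpolation points
    distinct. The pairs include a = b, which excludes 1 and -1. *)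
Definition generic (xs us : seq L) :=
  [/\ uniq (xs ++ us), {in xs ++ us, forall a, a != 0},
      {in xs ++ us &, forall a b, a * b != 1} & {in us &, forall a b, t * a * b != 1}].

Lemma generic_sub xs us xs' us' :
  subseq xs' xs -> subseq us' us -> generic xs us -> generic xs' us'.
Proof.
move=> sx su [uq h0 h1 ht].
have ss := cat_subseq sx su; have sm := mem_subseq ss.
split; first exact: subseq_uniq ss uq.
- by move=> a /sm; apply: h0.
- by move=> a b /sm sa /sm; apply: h1.
by move=> a b /(mem_subseq su) sa /(mem_subseq su); apply: ht.
Qed.

Lemma perm_generic xs us us' : perm_eq us us' -> generic xs us -> generic xs us'.
Proof.
move=> pu [uq h0 h1 ht].
have pe : perm_eq (xs ++ us) (xs ++ us') by rewrite perm_cat2l.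
split; first by rewrite -(perm_uniq pe).
- by move=> a; rewrite -(perm_mem pe); apply: h0.
- by move=> a b; rewrite -!(perm_mem pe); apply: h1.
by move=> a b; rewrite -!(perm_mem pu); apply: ht.
Qed.

Definition phi_num (us : seq L) (z : L) : L :=
  (1 - t * z ^+ 2) * \prod_(u <- us) ((z - t * u) * (1 - u * z)).
Definition phiV_num (us : seq L) (z : L) : L :=
  (t - z ^+ 2) * \prod_(u <- us) ((1 - t * u * z) * (z - u)).
Definition phi_den (us : seq L) (z : L) : L :=
  (1 - z ^+ 2) * \prod_(u <- us) ((z - u) * (1 - u * z)).

Lemma phi_phi_den us z : z != 0 -> z ^+ 2 != 1 -> z \notin us ->
  phi us z * phi_den us z = phi_num us z.
Proof.
move=> z0 z1 zus; rewrite /phi /phi_den /phi_num.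
rewrite mulrACA; congr (_ * _); first by rewrite mulfVK // subr_eq0 eq_sym.
rewrite -big_split; apply: eq_big_seq => u uus /=.
have uz : z - u != 0 by rewrite subr_eq0; apply: contra zus => /eqP ->.
by field; rewrite z0 uz.
Qed.

Lemma phiV_phi_den us z : z != 0 -> z ^+ 2 != 1 -> {in us, forall u, u * z != 1} ->
  phi us z^-1 * phi_den us z = phiV_num us z.
Proof.
move=> z0 z1 zus; rewrite /phi /phi_den /phiV_num mulrACA; congr (_ * _).
  by field; rewrite z0 subr_eq0 z1.
rewrite -big_split; apply: eq_big_seq => u uus /=.
have uz : 1 - u * z != 0 by rewrite subr_eq0 eq_sym zus.
by rewrite invrK; field.
Qed.

Definition rnumweight (xs : seq L) (z : L) (p : L * bool) : L :=
  if p.2 then (1 - t * p.1 * z) * (z - t * p.1) * Rprod xs p.1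
  else t ^+ (size xs).+1 * ((z - p.1) * (1 - p.1 * z)).

(** In [z], [rsum] has poles only at the entries of [us] and their inverses. The rest of the common
    denominator stays in front and makes [rnum] vanish on [xs]. *)
Definition rnum (us xs : seq L) (z : L) : L :=
  (1 - z ^+ 2) * (\prod_(x <- xs) polepart 1 z x) *
  bsum us (weight t^-1 1 t (rnumweight xs z)).

Lemma rsum_rnum us xs z : z != 0 -> z \notin us -> {in us, forall u, u * z != 1} ->
  rsum us (z :: xs) * (phi_den us z * \prod_(x <- xs) polepart 1 z x) = rnum us xs z.
Proof.
move=> z0 zus zus1; rewrite /rnum /phi_den /rsum.
have -> : bsum us (weight t^-1 1 t (rnumweight xs z)) =
   (\prod_(u <- us) ((z - u) * (1 - u * z))) *
   bsum us (weight t^-1 1 t (rweight (z :: xs))).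
  rewrite -bsum_prodM; apply: eq_bsum => l lus; rewrite -weightM.
  apply: eq_in_weight => -[u b] pl.
  have uus : u \in us by rewrite -lus (map_f fst pl).
  rewrite /rnumweight /rweight /=; case: b {pl} => /=; last by rewrite mulrC.
  rewrite /Rprod big_cons [RHS]mulrA; congr (_ * _).
  have h1 : 1 - u * z != 0 by rewrite subr_eq0 eq_sym zus1.
  have h2 : z - u != 0 by rewrite subr_eq0; apply: contra zus => /eqP ->.
  by field; rewrite z0 h1 h2.
by rewrite mulrC -!mulrA; congr (_ * _); rewrite mulrCA.
Qed.

Definition numdiff (us xs : seq L) (z : L) : L :=
  numsum 1 t 1 (fun p => phi us (branch 1 p)) (phi_num us) (phiV_num us) xs z -
  qpoch_at ((size xs).+1%:Z - (size us)%:Z) * rnum us xs z.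

Lemma perm_numdiff us us' xs z : perm_eq us us' -> numdiff us xs z = numdiff us' xs z.
Proof.
move=> pu; rewrite /numdiff (perm_size pu).
have -> : rnum us xs z = rnum us' xs z.
  by rewrite /rnum; congr (_ * _); apply: perm_bsum pu => l1 l2; apply: perm_weight.
congr (_ - _); rewrite /phi_num /phiV_num.
apply: eq_bsum => l _; rewrite !(perm_big _ pu); congr (_ * _).
by apply: eq_in_weight => p _; rewrite /phi (perm_big _ pu).
Qed.

(** Inversion swaps the branches of [z], so [phi_num] with [phiV_num] and [num0] with [num1]. The
    sign comes from the factor [1 - z ^+ 2] of the common denominator, its other factors being
    invariant up to powers of [z]. *)
Lemma numdiffV us xs z : z != 0 -> {in xs, forall x, x != 0} ->
  numdiff us xs z^-1 * (z ^+ 2 * (z ^+ 2) ^+ size us * (z ^+ 2) ^+ size xs) = - numdiff us xs z.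
Proof.
move=> z0 xs0; set Z := z ^+ 2.
have e0V : phi_num us z^-1 * (Z * Z ^+ size us) = - phiV_num us z.
  rewrite /phi_num /phiV_num mulrACA prodM_exp -[in RHS]mulNr.
  congr (_ * _); first by rewrite /Z; field.
  by apply: eq_bigr => u _; rewrite /Z; field.
have e1V : phiV_num us z^-1 * (Z * Z ^+ size us) = - phi_num us z.
  rewrite /phi_num /phiV_num mulrACA prodM_exp -[in RHS]mulNr.
  congr (_ * _); first by rewrite /Z; field.
  by apply: eq_bigr => u _; rewrite /Z; field.
rewrite /numdiff mulrBl opprB addrC; congr (_ + _).
  rewrite /rnum; have -> : 1 - z^-1 ^+ 2 = - (1 - z ^+ 2) / Z by rewrite /Z; field.
  have -> : \prod_(x <- xs) polepart 1 z x =
      (\prod_(x <- xs) polepart 1 z^-1 x) * Z ^+ size xs.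
    rewrite prodM_exp; apply: eq_big_seq => x /xs0 x0.
    by rewrite /polepart /Z; field; rewrite ?x0 ?z0.
  have -> : bsum us (weight t^-1 1 t (rnumweight xs z)) = 
      Z ^+ size us * bsum us (weight t^-1 1 t (rnumweight xs z^-1)).
    rewrite -prod_const_seq -bsum_prodM; apply: eq_bsum => l _; rewrite -weightM.
    apply: eq_in_weight => -[u b] _; rewrite /rnumweight /Z /=.
    by case: b; field.
  by rewrite /Z; field.
rewrite mulrC mulr_bsumr -[RHS]mulN1r mulr_bsumr; apply: eq_bsum => l lxs.
have lP p : p \in l -> branch 1 p != 0.
  by move=> pl; apply: (branch_neq0 (mulr1 1)); rewrite xs0 // -lxs map_f.
have sl : size xs = size l by rewrite -lxs size_map.
have n0V : (\prod_(p <- l) num0 t z^-1 (branch 1 p)) * Z ^+ size xs =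
    \prod_(p <- l) num1 1 t 1 z (branch 1 p).
  rewrite sl prodM_exp; apply: eq_big_seq => p /lP p0.
  by rewrite /num0 /num1 /Z; field; rewrite ?p0 ?z0.
have n1V : (\prod_(p <- l) num1 1 t 1 z^-1 (branch 1 p)) * Z ^+ size xs =
    \prod_(p <- l) num0 t z (branch 1 p).
  rewrite sl prodM_exp; apply: eq_big_seq => p /lP p0.
  by rewrite /num0 /num1 /Z; field; rewrite ?p0 ?z0.
rewrite -n0V -n1V -[phi_num us z]opprK -[phiV_num us z]opprK -e0V -e1V; ring.
Qed.

(** At 0 the variable [z] decouples: [num0] is -1 and [num1] is -t on every branch, so its two
    branches contribute t^r and t^n, where n counts [z] too. *)
Lemma numsum_at0 us xs : {in xs, forall x, x != 0} ->
  numsum 1 t 1 (fun p => phi us (branch 1 p)) (phi_num us) (phiV_num us) xs 0 =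
  (\prod_(u <- us) - u) * (\prod_(x <- xs) -1) *
  (t ^+ size us + t ^+ (size xs).+1) * lsum us xs.
Proof.
move=> xs0; rewrite mulr_bsumr; apply: eq_bsum => l lxs.
have lP p : p \in l -> branch 1 p != 0.
  by move=> pl; apply: (branch_neq0 (mulr1 1)); rewrite xs0 // -lxs map_f.
have -> : phi_num us 0 = (\prod_(u <- us) - u) * t ^+ size us.
  rewrite prodM_exp /phi_num expr0n /= mulr0 subr0 mul1r.
  by apply: eq_bigr => u _; ring.
have -> : phiV_num us 0 = t * \prod_(u <- us) - u.
  by rewrite /phiV_num expr0n /= subr0; congr (_ * _); apply: eq_bigr => u _; ring.
have -> : \prod_(p <- l) num0 t 0 (branch 1 p) = \prod_(x <- xs) -1.
  rewrite -lxs big_map; apply: eq_big_seq => p /lP p0.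
  by rewrite /num0; field.
have -> : \prod_(p <- l) num1 1 t 1 0 (branch 1 p) = (\prod_(x <- xs) -1) * t ^+ size xs.
  rewrite prodM_exp -lxs big_map; apply: eq_big_seq => p /lP p0.
  by rewrite /num1; field.
by rewrite exprS; ring.
Qed.

Lemma rnum_at0 us xs : {in xs, forall x, x != 0} ->
  rnum us xs 0 = (\prod_(u <- us) - u) * (\prod_(x <- xs) -1) *
  t ^+ size us * rsum us xs.
Proof.
move=> xs0; rewrite /rnum expr0n /= subr0 mul1r.
have -> : \prod_(x <- xs) polepart 1 0 x = \prod_(x <- xs) -1.
  by apply: eq_big_seq => x /xs0 x0; rewrite /polepart; field.
have -> : bsum us (weight t^-1 1 t (rnumweight xs 0)) =
    (\prod_(u <- us) (- u * t)) * rsum us xs.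
  rewrite -bsum_prodM; apply: eq_bsum => l _; rewrite -weightM.
  apply: eq_in_weight => -[u b] _; rewrite /rnumweight /rweight /=.
  by case: b; rewrite ?exprS; ring.
by rewrite -prodM_exp; ring.
Qed.

(** What both sides split off at [z = u]; the identity without [z] and [u] remains. *)
Definition resfactor (us xs : seq L) (u : L) : L :=
  (1 - u ^+ 2) * (1 - t * u ^+ 2) * (u - t * u) *
  (\prod_(v <- us) ((u - t * v) * (1 - v * u))) *
  \prod_(x <- xs) - ((1 - t * u * x) * (1 - t * u / x)).

(** [phiV_num] vanishes at [z = u], so only the branch [z] survives. On a branch y, [num0] times the
    factor of [u] in [phi] is -(1 - tuy)(1 - tu/y), which is invariant under y -> 1/y and leaves the
    sum. *)
Lemma numsum_at_u u us xs : generic xs (u :: us) ->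
  numsum 1 t 1 (fun p => phi (u :: us) (branch 1 p)) (phi_num (u :: us)) (phiV_num (u :: us)) xs u =
  resfactor us xs u * lsum us xs.
Proof.
move=> [uq h0 h1 ht].
have e1u : phiV_num (u :: us) u = 0 by rewrite /phiV_num big_cons subrr !mulr0 mul0r mulr0.
have -> : resfactor us xs u =
  phi_num (u :: us) u * \prod_(x <- xs) - ((1 - t * u * x) * (1 - t * u / x)).
  by rewrite /resfactor /phi_num big_cons; ring.
rewrite -mulrA -bsum_prodM mulr_bsumr; apply: eq_bsum => l lxs.
rewrite e1u mul0r addr0 mulrCA; congr (_ * _).
have -> : weight 1 t 1 (fun p => phi (u :: us) (branch 1 p)) l =
   (\prod_(p <- l) ((1 - t * u / branch 1 p) / (1 - u / branch 1 p))) *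
   weight 1 t 1 (fun p => phi us (branch 1 p)) l.
  rewrite -weightM; apply: eq_in_weight => p _.
  by rewrite /phi big_cons; ring.
rewrite mulrAC -big_split; congr (_ * _); apply: eq_big_seq => -[x b] pl /=.
have xxs : x \in xs by rewrite -lxs (map_f fst pl).
have x0 : x != 0 by rewrite h0 // mem_cat xxs.
have xu : x - u != 0.
  rewrite subr_eq0; apply/eqP => xu; move: uq.
  by rewrite cat_uniq => /and3P[_ /hasPn/(_ u)]; rewrite inE eqxx -xu xxs => /(_ isT).
have xu1 : 1 - u * x != 0.
  by rewrite subr_eq0 eq_sym h1 // mem_cat ?xxs // inE eqxx orbT.
by case: b {pl}; rewrite /branch /num0 /=; field; rewrite ?x0 ?xu ?xu1 ?oner_neq0.
Qed.

(** The label [false] of [u] dies by its factor [z - u]. Under [true], the kernel with either branch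
    of another [v], times the cleared denominator of [v], yields the same (u - tv)(1 - vu). *)
Lemma rnum_at_u u us xs : generic xs (u :: us) ->
  rnum (u :: us) xs u = resfactor us xs u * rsum us xs.
Proof.
move=> [uq h0 h1 ht]; rewrite /rnum /=.
rewrite -bsumD.
have -> : resfactor us xs u = 
  (1 - u ^+ 2) * (\prod_(x <- xs) polepart 1 u x) *
  ((1 - t * u ^+ 2) * (u - t * u) * Rprod xs u *
   \prod_(v <- us) ((u - t * v) * (1 - v * u))).
  rewrite /resfactor; have -> : \prod_(x <- xs) - ((1 - t * u * x) * (1 - t * u / x)) =
     (\prod_(x <- xs) polepart 1 u x) * Rprod xs u.
    rewrite /Rprod -big_split; apply: eq_big_seq => x xxs /=.
    have x0 : x != 0 by rewrite h0 // mem_cat xxs.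
    have xu : x - u != 0.
      rewrite subr_eq0; apply/eqP => xu; move: uq.
      by rewrite cat_uniq => /and3P[_ /hasPn/(_ u)]; rewrite inE eqxx -xu xxs => /(_ isT).
    have xu1 : 1 - u * x != 0.
      by rewrite subr_eq0 eq_sym h1 // mem_cat ?xxs // inE eqxx orbT.
    by rewrite /polepart; field; rewrite x0 xu xu1.
  by ring.
rewrite -!mulrA -bsum_prodM; do 2 congr (_ * _).
rewrite !mulr_bsumr; apply: eq_bsum => l lus.
have rf : rnumweight xs u (u, false) = 0 by rewrite /rnumweight /= subrr mul0r mulr0.
have rt : rnumweight xs u (u, true) = (1 - t * u * u) * (u - t * u) * Rprod xs u by [].
rewrite !weight_cons rf rt !mul0r addr0.
have <- : (\prod_(p <- l) kernel 1 t (branch t^-1 (u, true) * branch t^-1 p)) *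
     weight t^-1 1 t (rnumweight xs u) l =
   (\prod_(p <- l) ((u - t * p.1) * (1 - p.1 * u))) * weight t^-1 1 t (rweight xs) l.
  rewrite -!weightM; apply: eq_in_weight => -[v b] pl /=.
  have vus : v \in us by rewrite -lus (map_f fst pl).
  have v0 : v != 0 by rewrite h0 // mem_cat inE vus !orbT.
  have vu : v - u != 0.
    rewrite subr_eq0; apply/eqP => vu; move: uq.
    by rewrite cat_uniq /= -vu vus !andbF.
  have tuv : 1 - t * (u * v) != 0.
    by rewrite mulrA subr_eq0 eq_sym ht // inE ?eqxx ?vus ?orbT.
  rewrite /rnumweight /rweight /kernel /branch /=; case: b {pl}.
    by field.
  by rewrite exprS; field; rewrite t0 v0 vu.
by ring.
Qed.

(** [z] and [u] disappear together, so the index n - r of the symbol does not change. *)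
Lemma numdiff_at_u us xs u :
    (forall us', generic xs us' ->
       lsum us' xs = qpoch_at ((size xs)%:Z - (size us')%:Z) * rsum us' xs) ->
  generic xs us -> u \in us -> numdiff us xs u = 0.
Proof.
move=> IH gen uus; have pu := perm_to_rem uus.
rewrite (perm_numdiff _ _ pu) /numdiff; have gen' := perm_generic pu gen.
rewrite numsum_at_u // rnum_at_u // IH; last first.
  by apply: generic_sub gen'; rewrite // subseq_cons.
rewrite /= -[in (size xs).+1]addn1 -[(size _).+1]addn1 !PoszD opprD addrACA subrr addr0.
by ring.
Qed.

Lemma lsum_rsum xs us : generic xs us ->
  lsum us xs = qpoch_at ((size xs)%:Z - (size us)%:Z) * rsum us xs.
Proof.
(* [us] must vary: at [z = u] the hypothesis is used with [u] removed. *)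
elim: xs us => [|z xs IHxs] us gen.
  have -> : lsum us [::] = 1 by rewrite /lsum /= /weight big_nil mul1r.
  case: gen => /= uus us0 _ ust.
  rewrite -(qpoch_at0 (size us)) -(bsum_kernel_typeD t0 uus us0 ust); congr (_ * _).
  apply: eq_bsum => l _; apply: eq_in_weight => -[u b] _.
  by rewrite /rweight /Rprod /= big_nil; case: b.
have genxs : generic xs us by apply: generic_sub gen; rewrite // subseq_cons.
case: (gen) => /= /andP[zN uq] h0 h1 ht.
have z0 : z != 0 by rewrite h0 // inE eqxx.
have z1 : z ^+ 2 != 1 by rewrite expr2 h1 // inE eqxx.
have in0 a : a \in xs ++ us -> a != 0 by move=> sa; rewrite h0 // inE sa orbT.
have in1 a b : a \in xs ++ us -> b \in xs ++ us -> a * b != 1.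
  by move=> sa sb; rewrite h1 // inE ?sa ?sb orbT.
have inx a : a \in xs -> a \in xs ++ us by rewrite mem_cat => ->.
have inu a : a \in us -> a \in xs ++ us by rewrite mem_cat orbC => ->.
have zus : z \notin us by apply: contra zN => /inu.
have zus1 : {in us, forall u, u * z != 1}.
  by move=> u /inu us'; rewrite h1 // inE ?eqxx // us' orbT.
have xs0 : {in xs, forall x, x != 0} by move=> x /inx/in0.
have mz : {in xs, forall x, polepart 1 z x != 0}.
  move=> x xxs; apply: (polepart_neq0 (mulr1 1)); rewrite ?xs0 //.
    by apply: contra zN => /eqP ->; apply: inx.
  by rewrite h1 // inE ?eqxx // inx // orbT.
have ez : phi_den us z != 0.
  apply: mulf_neq0; first by rewrite subr_eq0 eq_sym.
  rewrite prodf_seq_neq0; apply/allP => u uus.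
  rewrite mulf_neq0 ?subr_eq0 //; last by rewrite eq_sym zus1.
  by apply: contra zus => /eqP ->.
suff N0 : numdiff us xs z = 0.
  have := bsum_numsum t (phi := fun p => phi us (branch 1 p)) (mulr1 1) z0 xs0 mz
    (phi_phi_den z0 z1 zus).
  rewrite /branch /= div1r => /(_ _ (phiV_phi_den z0 z1 zus1)).
  rewrite -/(branch _) (subr0_eq N0) -rsum_rnum // mulrA => /mulIf; apply.
  by rewrite mulf_neq0 // prodf_seq_neq0; apply/allP => x /mz.
have uq_all := uniq_flip (oner_neq0 L) uq in0 in1.
(* The case k = 0 of [tX1]; it separates 1 from -1 and turns N = -N into N = 0 at these two
   points. *)
have two0 : 1 + 1 != 0 :> L by rewrite -[X in X + _](expr0 t).
have N0V a : a != 0 -> numdiff us xs a = 0 -> numdiff us xs a^-1 = 0.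
  move=> a0 Na; have := numdiffV us a0 xs0; rewrite Na oppr0 => /eqP.
  by rewrite !mulf_eq0 !expf_eq0 (negPf a0) /= !andbF !orbF => /eqP.
have N01 a : a ^+ 2 = 1 -> a^-1 = a -> a != 0 -> numdiff us xs a = 0.
  move=> a2 av a0; have := numdiffV us a0 xs0; rewrite av a2 !expr1n !mulr1 => /eqP.
  rewrite -addr_eq0 -[X in X + _]mul1r -[X in _ + X]mul1r -mulrDl mulf_eq0 (negPf two0).
  by move=> /eqP.
pose rs := [:: 0, 1, -1 & (xs ++ us) ++ [seq 1 / a | a <- xs ++ us]].
apply: (@polyfun_eq0 _ (2 + 2 * size us + 2 * size xs) _ rs).
- have pe (a b : L) : polyfun 2 (fun z => a + b * z ^+ 2).
    apply: polyfunD (polyfunC _ _) _; apply: polyfunMl.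
    exact: (polyfunM (polyfun_id L) (polyfun_id L)).
  have pa (a b c d : L) : polyfun 2 (fun z => (a + b * z) * (c + d * z)).
    exact: (@polyfunM _ 1 1 _ _ (polyfun_affine _ _) (polyfun_affine _ _)).
  apply: polyfunB.
    apply: polyfun_numsum; apply: polyfunM.
    + by apply: eq_polyfun (pe 1 (- t)) => y; ring.
    + apply: polyfun_prod => u; apply: eq_polyfun (pa (- (t * u)) 1 1 (- u)) => y; ring.
    + by apply: eq_polyfun (pe t (-1)) => y; ring.
    apply: polyfun_prod => u; apply: eq_polyfun (pa 1 (- (t * u)) (- u) 1) => y; ring.
  apply: polyfunMl; rewrite addnAC; apply: polyfunM; first apply: polyfunM.
  + by apply: eq_polyfun (pe 1 (-1)) => y; ring.
  + exact: polyfun_polepart.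
  apply: polyfun_bsum => l lus; rewrite /weight -lus size_map.
  rewrite -[(2 * size l)%N]addn0; apply: polyfunM (polyfunC _ _).
  apply: polyfun_prod => -[u []]; rewrite /rnumweight /=.
    by apply: eq_polyfun (polyfunMl (Rprod xs u) (pa 1 (- (t * u)) (- (t * u)) 1)) => y; ring.
  by apply: eq_polyfun (polyfunMl (t ^+ (size xs).+1) (pa (- u) 1 1 (- u))) => y; ring.
- have one0 := oner_neq0 L.
  have flipP b : b \in (xs ++ us) ++ [seq 1 / a | a <- xs ++ us] -> b != 0 /\ b ^+ 2 != 1.
    rewrite mem_cat => /orP[sb|/mapP[a sa ->]]; first by rewrite in0 // expr2 in1.
    rewrite div1r invr_eq0 in0 // expr2 -invfM invr_eq1 in1 //.
  rewrite /rs 3!cons_uniq uq_all andbT !inE !negb_or.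
  rewrite eq_sym one0 eq_sym oppr_eq0 one0 -subr_eq0 opprK two0 /=.
  apply/and3P; split; apply/negP => /flipP[]; rewrite ?eqxx //.
    by rewrite expr1n eqxx.
  by rewrite sqrrN expr1n eqxx.
- by rewrite /rs /= !size_cat size_map size_cat; lia.
move=> a; rewrite !inE => /or4P[/eqP->|/eqP->|/eqP->|].
- rewrite /numdiff numsum_at0 // rnum_at0 // IHxs //.
  have := qpoch_atS (size xs) (size us); set A := qpoch_at _; set B := qpoch_at _ => h.
  set P := \prod_(u <- us) _; set Q := \prod_(x <- xs) _; set S := rsum _ _.
  have -> : P * Q * (t ^+ size us + t ^+ (size xs).+1) * (A * S) =
    P * Q * S * ((t ^+ size us + t ^+ (size xs).+1) * A) by ring.
  by rewrite h; ring.
- by apply: N01; rewrite ?expr1n ?invr1 ?oner_neq0.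
- by apply: N01; rewrite ?sqrrN ?expr1n ?invrN1 ?oppr_eq0 ?oner_neq0.
(* The compatibility asked by [numsum_root]: both sides equal phi(x) phi(1/x) times
   [phi_den us x]. *)
have phiE x : x != 0 -> x ^+ 2 != 1 -> x \notin us -> {in us, forall u, u * x != 1} ->
    phi us (branch 1 (x, true)) * phiV_num us x = phi us (branch 1 (x, false)) * phi_num us x.
  move=> x0 x1 xus xus1; rewrite /branch /= div1r -phi_phi_den // -phiV_phi_den //.
  by ring.
have Nx x : x \in xs -> numdiff us xs x = 0.
  move=> xxs; rewrite /numdiff (numsum_root _ (mulr1 1)) //.
  - rewrite /rnum (big_rem x) //= /polepart subrr mulr0 mul0r mulr0 mul0r mulr0 subrr //.
  - by move: uq; rewrite cat_uniq => /andP[].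
  - by move=> a' b' /inx sa /inx; apply: in1.
  apply: phiE; rewrite ?xs0 // ?expr2 ?in1 ?inx //.
    move: uq; rewrite cat_uniq => /and3P[_ /hasPn h _].
    by apply/negP => /h; rewrite xxs.
  by move=> u /inu uus; rewrite in1 // inx.
have Nu u : u \in us -> numdiff us xs u = 0 by apply: numdiff_at_u.
have Nxu b : b \in xs ++ us -> numdiff us xs b = 0.
  by rewrite mem_cat => /orP[/Nx|/Nu].
rewrite mem_cat => /orP[/Nxu//|/mapP[b sb ->]].
by rewrite div1r N0V ?in0 ?Nxu.
Qed.

End GenericIdentity.

Lemma big_enumE (R : Type) (idx : R) (op : R -> R -> R) (I : finType) (F : I -> R) :
  \big[op/idx]_i F i = \big[op/idx]_(i <- enum I) F i.
Proof. by rewrite [index_enum _]unlock -enumT. Qed.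

Lemma rmorph_bsum (R S : comNzRingType) (f : {rmorphism R -> S}) (A : Type)
    (s : seq A) (g : seq (A * bool) -> R) :
  f (bsum s g) = bsum s (fun l => f (g l)).
Proof. by elim: s g => //= a s IHs g; rewrite rmorphD !IHs. Qed.

(** * The operators T_i as field endomorphisms *)

Section Fraction.
Variable D : idomainType.
Local Notation tofrac := (@FracField.tofrac D).

Lemma tofrac_repr (f : {fraction D}) :
  tofrac \n_(repr f) / tofrac \d_(repr f) = f.
Proof.
have d0 := denom_ratioP (repr f).
apply: (canLR (mulfK _)); first by rewrite tofrac_eq0.
rewrite -{2}[f]reprK; apply/eqP; rewrite piE FracField.equivfE /=.
by rewrite !numden_Ratio ?mulf_neq0 ?oner_neq0 // !mulr1 mul1r.
Qed.

End Fraction.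

Section Inversion.
Variables (F : fieldType) (n r : nat).
Local Notation K := (ratfun F n r).
Local Notation N := (n + r + 1)%N.
Local Notation tofrac := (@FracField.tofrac {mpoly F[N]}).
Local Notation indet := (@indet F n r).

Local Notation substm s := (mmap ((tofrac \o @mpolyC N F) : {rmorphism F -> K}) s).

Lemma subst_polyE (s : 'I_N -> K) p : subst_poly s p = substm s p.
Proof. by []. Qed.

Definition inv_at (i : 'I_n) (j : 'I_N) : K :=
  if j == xpos r i then (indet j)^-1 else indet j.

Lemma indet_neq0 j : indet j != 0.
Proof.
rewrite tofrac_eq0; apply/eqP => /(congr1 (meval (fun=> 1))).
by rewrite mevalXU raddf0 => /eqP; rewrite oner_eq0.
Qed.

(* Multiplying by a high power of [x_i] turns the substitution into a
   permutation of monomials: the exponent of [x_i] is reversed. *)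
Lemma subst_inv_neq0 (i : 'I_n) (p : {mpoly F[N]}) : p != 0 -> substm (inv_at i) p != 0.
Proof.
move=> p0; pose d := msize p.
pose st (m : 'X_{1..N}) : 'X_{1..N} :=
  [multinom (if j == xpos r i then d - m j else m j)%N | j < N].
have md m j : m \in msupp p -> (m j <= d)%N.
  move=> /msize_mdeg_lt; rewrite mdegE (bigD1 j) //= => h.
  exact: leq_trans (leq_addr _ _) (ltnW h).
have stX m : m \in msupp p ->
    mmap1 (inv_at i) m * indet (xpos r i) ^+ d = tofrac 'X_[st m].
  move=> mp; rewrite /mmap1 mpolyXE_id rmorph_prod (bigD1 (xpos r i)) //=.
  rewrite [RHS](bigD1 (xpos r i)) //= mulrAC; congr (_ * _); last first.
    by apply: eq_bigr => j ji; rewrite rmorphXn /= /inv_at mnmE (negPf ji).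
  rewrite rmorphXn /= /inv_at mnmE eqxx exprVn mulrC -expfB_cond //.
  by rewrite (negPf (indet_neq0 _)) md.
pose w := \sum_(m <- msupp p) p@_m *: 'X_[st m].
have wE : substm (inv_at i) p * indet (xpos r i) ^+ d = tofrac w.
  rewrite /mmap mulr_suml rmorph_sum; apply: eq_big_seq => m mp.
  by rewrite -mulrA stX //= -mul_mpolyC rmorphM.
apply/eqP => p'0; move: wE; rewrite p'0 mul0r => /esym/eqP.
rewrite tofrac_eq0 => /eqP w0.
have m0 := mlead_supp p0; move: (m0); rewrite mcoeff_msupp => /eqP; apply.
have := congr1 (mcoeff (st (mlead p))) w0.
rewrite mcoeff0 raddf_sum (big_rem _ m0) /= mcoeffZ mcoeffX eqxx mulr1.
rewrite big_seq big1 ?addr0 // => m; rewrite mem_rem_uniq ?msupp_uniq // inE => /andP[mm mp].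
rewrite mcoeffZ mcoeffX; case: eqP => [e|]; last by rewrite mulr0.
case/eqP: mm; apply/mnmP => j; have := congr1 (fun m : 'X_{1..N} => m j) e.
rewrite !mnmE; case: ifP => // _ e'.
by have := md _ j mp; have := md _ j m0; lia.
Qed.

(** Independence of the chosen representative: cross-multiplied equalities survive the substitution,
    and no denominator becomes 0. *)
Lemma T_frac (i : 'I_n) (a b : {mpoly F[N]}) : b != 0 ->
  T i (tofrac a / tofrac b) = substm (inv_at i) a / substm (inv_at i) b.
Proof.
move=> b0; set f := _ / _.
have d0 := denom_ratioP (repr f).
have TE : T i f = substm (inv_at i) \n_(repr f) / substm (inv_at i) \d_(repr f).
  rewrite /T /subst !subst_polyE.
  have e : (fun j => if j == xpos r i then (x i)^-1 else indet j) =1 inv_at i.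
    by move=> j; rewrite /inv_at /x; case: eqP => // ->.
  by congr (_ / _); apply: eq_bigr => m _; congr (_ * _); apply: mmap1_eq.
rewrite TE; apply/eqP; rewrite eqr_div ?subst_inv_neq0 //.
rewrite -!rmorphM /=; apply/eqP; congr (mmap _ _ _).
apply/eqP; rewrite -(tofrac_eq) !rmorphM /= -eqr_div ?tofrac_eq0 //.
by rewrite tofrac_repr.
Qed.

Lemma T_tofrac (i : 'I_n) (a : {mpoly F[N]}) : T i (tofrac a) = substm (inv_at i) a.
Proof.
by rewrite -[tofrac a]divr1 -(rmorph1 tofrac) T_frac ?oner_neq0 // rmorph1 divr1.
Qed.

Lemma T_zmod_morphism (i : 'I_n) : zmod_morphism (T i : K -> K).
Proof.
move=> f g; rewrite -[f]tofrac_repr -[g]tofrac_repr.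
have df := denom_ratioP (repr f); have dg := denom_ratioP (repr g).
rewrite -mulNr addf_div ?tofrac_eq0 // -rmorphN -!rmorphM -rmorphD /=.
rewrite !T_frac ?mulf_neq0 // rmorphD !rmorphM rmorphN /=.
by rewrite -mulNr addf_div ?subst_inv_neq0.
Qed.

Lemma T_monoid_morphism (i : 'I_n) : monoid_morphism (T i : K -> K).
Proof.
split; first by rewrite -(rmorph1 tofrac) T_tofrac !rmorph1.
move=> f g; rewrite -[f]tofrac_repr -[g]tofrac_repr.
have df := denom_ratioP (repr f); have dg := denom_ratioP (repr g).
rewrite mulf_div -!rmorphM /= !T_frac ?mulf_neq0 // !rmorphM /=.
by rewrite mulf_div.
Qed.

HB.instance Definition _ (i : 'I_n) :=
  GRing.isZmodMorphism.Build K K (T i) (T_zmod_morphism i).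
HB.instance Definition _ (i : 'I_n) :=
  GRing.isMonoidMorphism.Build K K (T i) (T_monoid_morphism i).

Lemma T_indet (i : 'I_n) j : T i (indet j) = inv_at i j.
Proof. by rewrite T_tofrac mmapX mmap1U. Qed.

(** One term of the expanded product of the 1 + T_i; being a ring morphism, it can be computed on
    the indeterminates. *)
Fixpoint Tseq (l : seq ('I_n * bool)) (f : K) : K :=
  if l is p :: l' then (if p.2 then Tseq l' f else T p.1 (Tseq l' f)) else f.

Lemma Tseq_zmod_morphism l : zmod_morphism (Tseq l).
Proof. by elim: l => //= -[i []] l IHl f g /=; rewrite IHl // rmorphB. Qed.

Lemma Tseq_monoid_morphism l : monoid_morphism (Tseq l).
Proof.
elim: l => [|[i b] l [IH1 IHM]]; first by [].
by case: b; split=> [|f g] /=; rewrite ?IH1 ?IHM // ?rmorph1 ?rmorphM.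
Qed.

HB.instance Definition _ l :=
  GRing.isZmodMorphism.Build K K (Tseq l) (Tseq_zmod_morphism l).
HB.instance Definition _ l :=
  GRing.isMonoidMorphism.Build K K (Tseq l) (Tseq_monoid_morphism l).

Lemma Tseq_fixed l j : (forall i, xpos r i != j) -> Tseq l (indet j) = indet j.
Proof.
move=> jx; elim: l => //= -[i []] l -> //=.
by rewrite T_indet /inv_at eq_sym (negPf (jx i)).
Qed.

Lemma xpos_inj : injective (@xpos n r).
Proof. by move=> i j /lshift_inj/lshift_inj. Qed.

(** Distinct indices ensure that x_i is inverted at most once, the other operators fixing both x_i
    and its inverse. *)
Lemma Tseq_x l p : uniq (map fst l) -> p \in l ->
  Tseq l (x p.1) = branch 1 (x p.1, p.2).
Proof.
have out i l' : i \notin map fst l' -> Tseq l' (x i) = x i.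
  elim: l' => //= -[j b] l' IHl'; rewrite inE negb_or /= => /andP[ij /IHl' e].
  case: b; rewrite /= e // /x T_indet /inv_at.
  by case: eqP => // /xpos_inj ji; rewrite ji eqxx in ij.
elim: l => //= q l IHl /andP[qN ul]; rewrite inE => /orP[/eqP->|pl].
  case: q qN => i [] /= /out e; rewrite e // /x T_indet /inv_at eqxx.
  by rewrite /branch /= div1r.
have pq : q.1 != p.1 by apply: contra qN => /eqP->; apply: map_f.
rewrite !IHl //; case: q {qN} pq => j [] //= pq.
have Tx : T j (x p.1 : K) = x p.1.
  by rewrite /x T_indet /inv_at; case: eqP => // /xpos_inj e; rewrite e eqxx in pq.
by rewrite /branch; case: ifP => _ /=; rewrite ?rmorphM ?rmorph1 ?fmorphV /= Tx.
Qed.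

Lemma calT_bsum (f : K) : calT f = bsum (enum 'I_n) (fun l => Tseq l f).
Proof.
rewrite /calT big_enumE; elim: (enum _) => [|i s IHs]; first by rewrite big_nil.
by rewrite big_cons /= IHs rmorph_bsum.
Qed.

End Inversion.

(** * Passage to the indeterminates *)

Section Transfer.
Variables (F : fieldType) (n r : nat).
Hypothesis two_neq0 : 1 + 1 != 0 :> F.
Local Notation K := (ratfun F n r).
Local Notation N := (n + r + 1)%N.
Local Notation tofrac := (@FracField.tofrac {mpoly F[N]}).
Local Notation indet := (@indet F n r).

Definition xseq : seq K := [seq x i | i <- enum 'I_n].
Definition useq : seq K := [seq u k | k <- enum 'I_r].

Lemma indet_inj : injective indet.
Proof.
move=> j k /eqP; rewrite tofrac_eq => /eqP /(congr1 (meval (fun i => (i == j)%:R))).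
by rewrite !mevalXU eqxx; case: eqP => // _ /eqP; rewrite oner_eq0.
Qed.

(** A multiple of an indeterminate vanishes at the origin. Both kinds of product in [generic] have
    this form. *)
Lemma indetM_neq1 j (p : {mpoly F[N]}) : tofrac p * indet j != 1.
Proof.
rewrite -(rmorph1 tofrac) -rmorphM tofrac_eq; apply/eqP => /(congr1 (meval (fun=> 0))).
by rewrite rmorphM rmorph1 /= mevalXU mulr0 => /esym/eqP; rewrite oner_eq0.
Qed.

(** At t = 1 the value is 2, nonzero in [F]. *)
Lemma tX1_neq0 k : (t : K) ^+ k + 1 != 0.
Proof.
rewrite -(rmorph1 tofrac) -rmorphXn -rmorphD tofrac_eq0; apply/eqP.
move=> /(congr1 (meval (fun=> 1))); rewrite rmorphD rmorphXn rmorph1 rmorph0 /= mevalXU expr1n.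
by apply/eqP.
Qed.

Lemma generic_indet : generic t xseq useq.
Proof.
have catE : xseq ++ useq =
    [seq indet j | j <- map (@xpos n r) (enum 'I_n) ++ map (@upos n r) (enum 'I_r)].
  by rewrite map_cat; congr (_ ++ _); rewrite -map_comp.
split.
- rewrite catE map_inj_uniq; last exact: indet_inj.
  have ux : uniq (map (@xpos n r) (enum 'I_n)).
    by rewrite (map_inj_uniq (@xpos_inj n r)) enum_uniq.
  have uu : uniq (map (@upos n r) (enum 'I_r)).
    rewrite map_inj_uniq; first exact: enum_uniq.
    by move=> i j /lshift_inj/rshift_inj.
  rewrite cat_uniq ux uu andbT; apply/hasPn => _ /mapP[k _ ->].
  apply/negP => /mapP[i _ /lshift_inj/eqP].
  by rewrite eq_sym eq_lrshift.
- by move=> a; rewrite catE => /mapP[j _ ->]; apply: indet_neq0.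
- by move=> a b; rewrite catE => /mapP[j _ ->] /mapP[k _ ->]; apply: indetM_neq1.
move=> a b /mapP[j _ ->] /mapP[k _ ->].
by rewrite -(rmorphM tofrac); apply: indetM_neq1.
Qed.

Lemma sorted_enum_ord m : sorted (fun i j : 'I_m => (i < j)%N) (enum 'I_m).
Proof.
have := iota_ltn_sorted 0 m; rewrite -val_enum_ord sorted_map.
by [].
Qed.

Lemma prod_pairs_ord m (k : 'I_m -> 'I_m -> K) :
  \prod_(i < m) \prod_(j < m | (i < j)%N) k i j = pprod k (enum 'I_m).
Proof.
rewrite -(@pprod_sorted _ _ k (fun i j : 'I_m => (i < j)%N)) ?sorted_enum_ord //.
- rewrite [LHS]big_enumE; apply: eq_bigr => i _.
  by rewrite -big_filter [index_enum _]unlock -enumT big_filter.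
- by move=> i; rewrite ltnn.
by move=> i j l; apply: ltn_trans.
Qed.

Lemma calT_lsum :
  calT (Phi_pi * \prod_(k < r) \prod_(i < n) ((1 - t * u k / x i) / (1 - u k / x i)) : K) =
  lsum t useq xseq.
Proof.
rewrite calT_bsum /lsum /xseq [RHS]bsum_map; apply: eq_bsum => l ll.
have ul : uniq (map fst l) by rewrite ll enum_uniq.
pose y i := Tseq l (x i : K).
(* The branches along [l] are the images of the x_i under [Tseq l], in the order of enumeration, so
   the weight is the image of the summand. *)
have ysE : [seq branch 1 p | p <- [seq (x p.1, p.2) | p <- l]] = [seq y i | i <- enum 'I_n].
  rewrite -ll -!map_comp; apply/eq_in_map => p pl /=.
  by rewrite /y Tseq_x.
have Tt : Tseq l (t : K) = t.
  by apply: Tseq_fixed => i; rewrite eq_lrshift.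
have Tu k : Tseq l (u k : K) = u k.
  apply: Tseq_fixed => i; apply/negP => /eqP/lshift_inj/eqP.
  by rewrite eq_lrshift.
rewrite rmorphM /Phi_pi rmorphM !rmorph_prod /=.
rewrite /weight -(big_map (branch 1) predT (phi t useq)).
rewrite -(pprod_map (branch 1) (fun a b => kernel t 1 (a * b))).
rewrite ysE big_map pprod_map -prod_pairs_ord -big_enumE.
rewrite mulrAC; congr (_ * _).
  rewrite /phi; under [RHS]eq_bigr do rewrite /useq big_map -big_enumE.
  rewrite big_split /=; congr (_ * _).
    by apply: eq_bigr => i _; rewrite !(fmorph_div, rmorphB, rmorphXn, rmorphM, rmorph1) /= Tt.
  rewrite exchange_big; apply: eq_bigr => k _; rewrite rmorph_prod; apply: eq_bigr => i _.
  by rewrite !(fmorph_div, rmorphB, rmorphM, rmorph1) /= Tt Tu.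
apply: eq_bigr => i _; rewrite rmorph_prod; apply: eq_bigr => j _.
by rewrite !(fmorph_div, rmorphB, rmorphM, rmorph1) /= Tt /kernel mul1r mulrA.
Qed.

Lemma rsum_sum :
  rsum t useq xseq = \sum_(I : {set 'I_r}) c F n I * \prod_(i in I) R (u i).
Proof.
rewrite /rsum /useq bsum_map bsum_set ?enum_uniq //.
apply: eq_big => [I|I _]; first by apply/subsetP => i; rewrite mem_enum.
rewrite -map_comp /= /weight big_map /c.
have -> : \prod_(i <- enum 'I_r) rweight t xseq (u i, i \in I) =
   t ^+ (n * (r - #|I|)) * \prod_(i in I) R (u i).
  rewrite -big_enumE (bigID (mem I)) /= mulrC; congr (_ * _).
    rewrite (eq_bigr (fun=> t ^+ n)) => [|i iI]; last first.
      by rewrite /rweight /= (negPf iI) size_map size_enum_ord.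
    rewrite prodr_const -exprM; congr (_ ^+ (_ * _)).
    have e := cardC (mem I); rewrite card_ord in e.
    transitivity #|[predC mem I]|; first exact: eq_card.
    by rewrite -[LHS](addKn #|mem I|) e.
  apply: eq_bigr => i iI; rewrite /rweight /= iI /Rprod /R /xseq big_map -big_enumE.
  by [].
rewrite -!mulrA; congr (_ * _); rewrite mulrC; congr (_ * _).
rewrite pprod_map -prod_pairs_ord; apply: eq_bigr => i _; apply: eq_bigr => j _.
have vE k : branch t^-1 (u k, k \in I) = v F n I k.
  by rewrite /branch /v /=; case: ifP => // _; rewrite invfM.
by rewrite /kernel /= !vE mul1r mulrA.
Qed.

End Transfer.

Theorem theorem6 (F : fieldType) (charF0 : [pchar F] =i pred0)
    (n r : nat) (n_gt0 : (1 <= n)%N) :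
  calT (Phi_pi * \prod_(k < r) \prod_(i < n)
                   ((1 - t * u k / x i) / (1 - u k / x i)) : ratfun F n r) =
  qpoch (n%:Z - r%:Z) *
    \sum_(I : {set 'I_r}) c F n I * \prod_(i in I) R (u i).
Proof.
have two0 : 1 + 1 != 0 :> F by have := charF0 2; rewrite !inE /= => /negbT.
rewrite calT_lsum -rsum_sum.
rewrite (lsum_rsum (@indet_neq0 F n r _) (@tX1_neq0 F n r two0) (@generic_indet F n r)).
by rewrite /xseq /useq !size_map -!enumT !size_enum_ord.
Qed.
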